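(* Let $n$ be a primitive non-deficient number with prime factorization $n=p_1^{a_1}p_2^{a_2}\cdots p_k^{a_k}$, where $p_1<p_2<\cdots<p_k$ are primes and all $a_i\ge 1$, and let $S=S(n)$ be its surplus. Then $$T(n)\ \geq\ \log 2-\frac{25}{64p_1}+\frac{S}{2}-\frac{S^2}{4}.$$
   Context: $\sigma(n)$ denotes the sum of the positive divisors of $n$. A positive integer $n$ is non-deficient if $\sigma(n)/n\ge 2$. A primitive non-deficient number is a non-deficient number having no proper divisor that is non-deficient. For a positive integer $n$, $T(n)=\sum_{p\mid n}\frac1p$ and $H(n)=\prod_{p\mid n}\frac{p}{p-1}$, where $p$ runs over the distinct prime divisors of $n$. For non-deficient $n$, the surplus is $S(n)=H(n)-2$. $\log$ is the natural logarithm. *)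

(* Defs.v *)
From HB Require Import structures.
From mathcomp Require Import all_boot all_order all_algebra.
From mathcomp Require Import reals exp.

Set Implicit Arguments.
Unset Strict Implicit.
Unset Printing Implicit Defensive.

Import Order.TTheory GRing.Theory Num.Theory.
Local Open Scope ring_scope.

Definition sigma (n : nat) : nat := (\sum_(d <- divisors n) d)%N.

Definition nondeficient (n : nat) : bool :=
  (0 < n)%N && (2 <= (sigma n)%:R / n%:R :> rat).

Definition primitive_nondeficient (n : nat) : Prop :=
  nondeficient n /\
  forall d : nat, (d %| n)%N -> d <> n -> ~~ nondeficient d.

(* [primes n] lists each prime divisor of [n > 0] exactly once. *)
Definition T (R : realType) (n : nat) : R := \sum_(p <- primes n) 1 / p%:R.

Definition H (R : realType) (n : nat) : R :=
  \prod_(p <- primes n) (p%:R / (p%:R - 1)).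

Definition surplus (R : realType) (n : nat) : R := H R n - 2.

(* Main.v *)
Require Import Defs.
From HB Require Import structures.
From mathcomp Require Import all_boot all_order all_algebra.
From mathcomp Require Import reals exp.
From mathcomp Require Import topology normedtype derive realfun.
From mathcomp Require Import zify ring lra.

Set Implicit Arguments.
Unset Strict Implicit.
Unset Printing Implicit Defensive.

Import Order.TTheory GRing.Theory Num.Theory.
Import numFieldNormedType.Exports.
Local Open Scope ring_scope.

(* Put u = S/2, so that ln (H n) = ln 2 + ln (1 + u) with ln (1 + u) >= u - u^2,
   valid for u >= -1/2, hence as soon as H n >= 1.
   It remains to bound the sum over p | n of the excess ln (p/(p-1)) - 1/p, which
   is at most 1/(2 p (p-1)), by 25/(64 p_1).  If p_1 is odd this holds because the
   prime divisors beyond 3 are coprime to 6, so their excesses are dominated by a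
   telescoping sum over the classes 1 and 5 modulo 6.  If p_1 = 2, then
   1 + u = prod p/(p-1) over the odd p | n, and sum 1/p over these p is at least
   1 - prod (1 - 1/p) = u/(1+u) >= u - u^2, so that ln 2 <= 1/2 + 25/128 is enough. *)

(** * Bounds for the logarithm *)

(** Twice the difference of the two sides vanishes at 1 and has the square [(1 - x^-1) ^+ 2] as
    derivative. *)
Lemma ln_le_half_diff (R : realType) (y : R) : 1 <= y -> ln y <= (y - y^-1) / 2.
Proof.
move=> y1; pose g (x : R) : R := x - x^-1 - (ln x + ln x).
have dg (x : R) : 0 < x -> is_derive x 1 g ((1 - x^-1) ^+ 2).
  move=> x0; have xn0 : x != 0 by rewrite gt_eqF.
  have dl := is_derive1_ln x0.
  have dV : is_derive x (1 : R) (fun t : R => t^-1) (- x ^- 2 *: (1 : R)).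
    exact: is_deriveV.
  rewrite /g; apply: is_derive_eq.
  by rewrite /GRing.scale /= mulr1; field.
suff : g 1 <= g y by rewrite /g invr1 ln1; lra.
have pos (x : R) : x \in `[1, y] -> 0 < x.
  by rewrite in_itv /= => /andP[/(lt_le_trans ltr01)].
have [c _ gE] : exists2 c, c \in `[1, y] &
    g y - g 1 = (1 - c^-1) ^+ 2 * (y - 1).
  apply: (@MVT_segment R g (fun x => (1 - x^-1) ^+ 2)) => //.
    by move=> x /subset_itv_oo_cc /pos; exact: dg.
  apply: derivable_within_continuous => x /pos x0.
  by have [] := dg x x0.
by rewrite -subr_ge0 gE mulr_ge0 ?sqr_ge0 // subr_ge0.
Qed.

(** For [u >= 0], [ln t <= t - 1] at [t = 1 / (1 + u)] suffices. For [u < 0] the sharper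
    [ln_le_half_diff] at the same [t] leaves a remainder with the factor [1 + 2 * u], whence the
    threshold. *)
Lemma ln_ge_sub_sqr (R : realType) (u : R) : - 2^-1 <= u -> u - u ^+ 2 <= ln (1 + u).
Proof.
move=> hu; have u1 : 0 < 1 + u by lra.
have -> : ln (1 + u) = - ln (1 + u)^-1 by rewrite lnV ?opprK.
have [u0|u0] := leP 0 u.
  have : ln (1 + ((1 + u)^-1 - 1)) <= (1 + u)^-1 - 1.
    by apply: le_ln1Dx; rewrite ltrBrDr addNr invr_gt0.
  rewrite addrC subrK => h.
  have : u - u ^+ 2 <= 1 - (1 + u)^-1.
    rewrite -subr_ge0.
    have -> : 1 - (1 + u)^-1 - (u - u ^+ 2) = u ^+ 3 / (1 + u).
      by field; rewrite gt_eqF.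
    by rewrite divr_ge0 ?exprn_ge0 // ltW.
  by move: h; set a := ln _; lra.
have h : ln (1 + u)^-1 <= ((1 + u)^-1 - (1 + u)) / 2.
  rewrite -[X in _ - X]invrK; apply: ln_le_half_diff.
  by rewrite -invr1 lef_pV2 ?posrE //; lra.
have : u - u ^+ 2 <= - (((1 + u)^-1 - (1 + u)) / 2).
  rewrite -subr_ge0.
  have -> : - (((1 + u)^-1 - (1 + u)) / 2) - (u - u ^+ 2) =
            u ^+ 2 * (1 + 2 * u) / (2 * (1 + u)).
    by field; rewrite gt_eqF.
  apply: divr_ge0; last by lra.
  by apply: mulr_ge0; [exact: sqr_ge0|lra].
by move: h; set a := ln _; lra.
Qed.

(** The trapezoidal bound for the integral of [1 / t] from [y] to [x]; it is [ln_le_half_diff] at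
    the ratio [x / y]. *)
Lemma ln_ratio_le (R : realType) (x y : R) : 0 < y -> x = y + 1 ->
  ln (x / y) <= (x^-1 + y^-1) / 2.
Proof.
move=> y0 ->; have yn0 : y != 0 by rewrite gt_eqF.
apply: le_trans (ln_le_half_diff _) _; first by rewrite ler_pdivlMr //; lra.
rewrite le_eqVlt; apply/orP; left; apply/eqP.
by field; rewrite yn0 gt_eqF //; lra.
Qed.

(** * The excess of a prime and its telescoping majorant *)

Definition excess (R : realType) (p : nat) : R :=
  ln (p%:R / (p%:R - 1)) - 1 / p%:R.

Lemma excess_le (R : realType) (p : nat) : (1 < p)%N ->
  excess R p <= 1 / (2 * p%:R * (p%:R - 1)).
Proof.
move=> p1; have x1 : 1 < p%:R :> R by rewrite ltr1n.
have y0 : 0 < p%:R - 1 :> R by rewrite subr_gt0.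
have xE : p%:R = p%:R - 1 + 1 :> R by rewrite subrK.
apply: le_trans (lerB (ln_ratio_le y0 xE) (lexx _)) _.
rewrite le_eqVlt; apply/orP; left; apply/eqP.
by field; rewrite subr_eq0 !gt_eqF //; lra.
Qed.

(* [tail m] bounds the sum of [1 / (2 * p * (p - 1))] over all [p >= m] coprime to 6,
   for [m] congruent to 1 or 5 modulo 6. *)
Definition tail1 (R : realType) (x : R) : R :=
  1 / (6 * x + 9) + 1 / (2 * x * (x - 1)).

(** Over one period of six it drops by [1 / (6 * x - 15) - 1 / (6 * x + 21)]. The constant 15 makes
    this drop a function of [x ^+ 2 + x], like the sum of the terms at [x] and [x + 2] that it has
    to dominate. *)
Definition tail5 (R : realType) (x : R) : R := 1 / (6 * x - 15).

Definition tail (R : realType) (m : nat) : R :=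
  if (m %% 6 == 1)%N then tail1 m%:R else tail5 m%:R.

Lemma tail1_anti (R : realType) (x y : R) : 5 <= x -> x <= y -> tail1 y <= tail1 x.
Proof.
move=> x5 xy; rewrite /tail1 !div1r; apply: lerD.
  by rewrite lef_pV2 ?posrE; lra.
by rewrite lef_pV2 ?posrE; nra.
Qed.

Lemma tail5_anti (R : realType) (x y : R) : 5 <= x -> x <= y -> tail5 y <= tail5 x.
Proof.
by move=> x5 xy; rewrite /tail5 !div1r lef_pV2 ?posrE; lra.
Qed.

Lemma tail5_step (R : realType) (x : R) : 5 <= x ->
  1 / (2 * x * (x - 1)) + tail1 (x + 2) <= tail5 x.
Proof.
move=> x5; rewrite -subr_ge0 /tail1 /tail5.
have -> : 1 / (6 * x - 15) - (1 / (2 * x * (x - 1)) +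
    (1 / (6 * (x + 2) + 9) + 1 / (2 * (x + 2) * (x + 2 - 1)))) =
  (23 * (x ^+ 2 + x) + 35) /
    ((2 * x - 5) * (2 * x + 7) * x * (x - 1) * (x + 1) * (x + 2)).
  by field; rewrite !gt_eqF //; lra.
by rewrite divr_ge0 ?mulr_ge0 //; nra.
Qed.

Lemma tail1_step (R : realType) (x : R) :
  1 / (2 * x * (x - 1)) + tail5 (x + 4) = tail1 x.
Proof.
by rewrite addrC /tail1 /tail5; congr (1 / _ + _); ring.
Qed.

Lemma tail_step (R : realType) (m q : nat) : (5 <= m)%N -> (m < q)%N ->
  coprime 6 m -> coprime 6 q ->
  1 / (2 * m%:R * (m%:R - 1)) + tail R q <= tail R m.
Proof.
have mod6 k : coprime 6 k -> (k %% 6 = 1 \/ k %% 6 = 5)%N.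
  rewrite -coprime_modr; have := ltn_pmod k (isT : 0 < 6)%N.
  by case: (k %% 6)%N => [|[|[|[|[|[|]]]]]] //; auto.
move=> m5 mq /mod6 hm /mod6 hq; rewrite /tail.
have x5 : 5 <= m%:R :> R by rewrite ler_nat.
have nat_le (d : nat) : (m + d <= q)%N -> m%:R + d%:R <= q%:R :> R.
  by rewrite -natrD ler_nat.
(* One step leads from [m] to the next number coprime to 6, [m + 4] or [m + 2], and monotonicity
   leads on to [q]. If [q] has the residue of [m], then [q >= m + 6], and the term of the other
   class in between is dropped. *)
case: hm hq => hm [] hq; rewrite hm hq /=.
- rewrite -[leRHS]tail1_step lerD2l.
  have h6 : m%:R + 6 <= q%:R :> R by apply: nat_le; lia.
  apply: (@le_trans _ _ (tail1 (m%:R + 4 + 2))); first by apply: tail1_anti; lra.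
  apply: le_trans (tail5_step _); last by lra.
  by rewrite lerDr divr_ge0 // mulr_ge0 //; lra.
- rewrite -[leRHS]tail1_step lerD2l.
  have h4 : m%:R + 4 <= q%:R :> R by apply: nat_le; lia.
  by apply: tail5_anti; lra.
- apply: le_trans (tail5_step x5); rewrite lerD2l.
  have h2 : m%:R + 2 <= q%:R :> R by apply: nat_le; lia.
  by apply: tail1_anti; lra.
apply: le_trans (tail5_step x5); rewrite lerD2l.
have h6 : m%:R + 6 <= q%:R :> R by apply: nat_le; lia.
apply: (@le_trans _ _ (tail5 (m%:R + 2 + 4))); first by apply: tail5_anti; lra.
by rewrite -tail1_step lerDr divr_ge0 // mulr_ge0 //; lra.
Qed.

Lemma coprime6_prime (p : nat) : prime p -> (5 <= p)%N -> coprime 6 p.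
Proof.
move=> p_pr p5; rewrite coprime_sym prime_coprime //.
apply/negP => p6; have := dvdn_leq (isT : 0 < 6)%N p6.
by case: p p_pr p5 p6 => [|[|[|[|[|[|[|]]]]]]].
Qed.

Lemma tail_anti (R : realType) (m q : nat) : (5 <= m)%N -> (m <= q)%N ->
  coprime 6 m -> coprime 6 q -> tail R q <= tail R m.
Proof.
move=> m5; rewrite leq_eqVlt => /predU1P[-> //|mq] cm cq.
have x5 : 5 <= m%:R :> R by rewrite ler_nat.
apply: le_trans (tail_step R m5 mq cm cq).
by rewrite lerDr divr_ge0 // mulr_ge0 //; lra.
Qed.

(** Each excess is paid for by the drop of [tail] up to the next prime; at the last prime, [tail]
    still covers that prime's own term. *)
Lemma sum_excess_le_tail (R : realType) (m : nat) (s : seq nat) :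
  (5 <= m)%N -> path ltn m s -> all prime (m :: s) ->
  \sum_(p <- m :: s) excess R p <= tail R m.
Proof.
elim: s m => [|q s IH] m m5 /=.
  move=> _; rewrite andbT big_seq1 => m_pr.
  have x5 : 5 <= m%:R :> R by rewrite ler_nat.
  apply: le_trans (excess_le _ (prime_gt1 m_pr)) _.
  rewrite /tail; case: ifP => _; first by rewrite -tail1_step lerDl divr_ge0 //; lra.
  apply: le_trans (tail5_step x5); rewrite lerDl /tail1.
  by apply: addr_ge0; rewrite divr_ge0 // ?mulr_ge0 //; lra.
move=> /andP[mq qs] /and3P[m_pr q_pr s_pr].
have q5 : (5 <= q)%N by apply: leq_trans (ltnW mq).
rewrite big_cons; apply: le_trans (tail_step R m5 mq _ _);
  try exact: coprime6_prime.
apply: lerD; first exact: (excess_le _ (prime_gt1 m_pr)).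
by apply: IH => //=; rewrite q_pr.
Qed.

(** * Numerical bounds and the total excess *)

(** The bound 1/12 from [excess_le] is too weak for the case [q = 3] of [sum_excess_le], so the
    trapezoidal rule is applied on a finer subdivision of 3/2 = 9/6. *)
Lemma excess3_le (R : realType) :
  excess R 3 <= 1 / 12 + 1 / 7 + 1 / 8 + 1 / 18 - 1 / 3.
Proof.
have h := @ln_ratio_le R; rewrite /excess.
have -> : 3 / (3 - 1) = (7 / 6) * (8 / 7) * (9 / 8) :> R by field.
do 2![rewrite lnM ?posrE ?mulr_gt0 ?invr_gt0 //].
have := h 7 6 ltac:(lra) ltac:(lra);
have := h 8 7 ltac:(lra) ltac:(lra);
have := h 9 8 ltac:(lra) ltac:(lra); lra.
Qed.

(** The constant is 1/2 + 25/128, exactly what the case of smallest prime 2 allows. *)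
Lemma ln2_le (R : realType) : ln 2 <= 89 / 128 :> R.
Proof.
have h := @ln_ratio_le R.
(* Six factors are the fewest for which the trapezoidal bounds reach 89/128. *)
have -> : 2 = (7 / 6) * (8 / 7) * (9 / 8) * (10 / 9) * (11 / 10) * (12 / 11) :> R
  by field.
do 5![rewrite lnM ?posrE ?mulr_gt0 ?invr_gt0 //].
have := h 7 6 ltac:(lra) ltac:(lra);
have := h 8 7 ltac:(lra) ltac:(lra);
have := h 9 8 ltac:(lra) ltac:(lra);
have := h 10 9 ltac:(lra) ltac:(lra);
have := h 11 10 ltac:(lra) ltac:(lra);
have := h 12 11 ltac:(lra) ltac:(lra); lra.
Qed.

Lemma sum_excess_le (R : realType) (q : nat) (s : seq nat) :
  (3 <= q)%N -> path ltn q s -> all prime (q :: s) ->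
  \sum_(p <- q :: s) excess R p <= 25 / (64 * q%:R).
Proof.
have c7 : tail R 7 = 1 / 51 + 1 / 84 by rewrite /tail /= /tail1; field.
rewrite leq_eqVlt => /predU1P[<-|].
  (* For [q = 3] there is little room: 3 and 5 are bounded individually and [tail] serves only from
     7 on. The total is about 0.1299, against 25/192, about 0.1302. *)
  have tail_le_tail7 r s' : (3 < r)%N -> path ltn r s' -> all prime (r :: s') ->
      r != 5%N -> \sum_(p <- r :: s') excess R p <= tail R 7.
    move=> r4 rs pr_s r5; have /andP[r_pr _] := pr_s.
    have r7 : (7 <= r)%N.
      by case: r r4 r5 r_pr {rs pr_s} => [|[|[|[|[|[|[|]]]]]]].
    apply: le_trans (sum_excess_le_tail R _ rs pr_s) _; first exact: leq_trans r7.
    by apply: tail_anti => //; apply: coprime6_prime => //; exact: leq_trans r7.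
  have e3 := excess3_le R.
  have e5 : excess R 5 <= 1 / 40.
    have -> : 40 = 2 * 5 * (5 - 1) :> R by ring.
    exact: excess_le.
  rewrite big_cons; case: s => [|r s]; first by rewrite big_nil; lra.
  move=> /= /andP[r3 rs] /andP[pr_r pr_s].
  have [r5|r5] := eqVneq r 5%N; last first.
    by have := tail_le_tail7 r s r3 rs (introT andP (conj pr_r pr_s)) r5; lra.
  move: rs; rewrite r5 big_cons.
  case: s pr_s => [|t s] pr_s /=; first by rewrite big_nil; lra.
  move=> /andP[t5 ts]; have := tail_le_tail7 t s (ltnW (ltnW t5)) ts pr_s.
  by rewrite gtn_eqF // => /(_ isT); lra.
move=> q4 qs prs; have /andP[q_pr _] := prs.
have q5 : (5 <= q)%N by case: q q4 q_pr {qs prs} => [|[|[|[|[|]]]]].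
have x5 : 5 <= q%:R :> R by rewrite ler_nat.
apply: le_trans (sum_excess_le_tail R q5 qs prs) _.
(* From 5 on, [tail] alone is below the target in both residue classes. *)
rewrite -subr_ge0 /tail /tail1 /tail5; case: ifP => _.
  have -> : 25 / (64 * q%:R) - (1 / (6 * q%:R + 9) + 1 / (2 * q%:R * (q%:R - 1))) =
     (25 * (6 * q%:R + 9) * (q%:R - 1) - 64 * q%:R * (q%:R - 1) - 32 * (6 * q%:R + 9))
      / (64 * q%:R * (6 * q%:R + 9) * (q%:R - 1)) :> R.
    by field; rewrite !gt_eqF //; lra.
  apply: divr_ge0; first by nra.
  by do 3![apply: mulr_ge0; last lra].
have -> : 25 / (64 * q%:R) - 1 / (6 * q%:R - 15) =
   (25 * (6 * q%:R - 15) - 64 * q%:R) / (64 * q%:R * (6 * q%:R - 15)) :> R.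
  by field; rewrite !gt_eqF //; lra.
apply: divr_ge0; first by lra.
by apply: mulr_ge0; lra.
Qed.

(** * From products over primes to the inequality *)

Lemma prod_ratio_ge1 (R : realType) (s : seq nat) : all (ltn 1) s ->
  1 <= \prod_(p <- s) (p%:R / (p%:R - 1)) :> R.
Proof.
elim: s => [|p s IH] /=; first by rewrite big_nil.
move=> /andP[p1 /IH s1]; rewrite big_cons; apply: mulr_ege1 => //.
have x1 : 1 < p%:R :> R by rewrite ltr1n.
by rewrite ler_pdivlMr ?subr_gt0 // mul1r gerBl.
Qed.

Lemma ln_prod_ratio (R : realType) (s : seq nat) : all (ltn 1) s ->
  ln (\prod_(p <- s) (p%:R / (p%:R - 1))) =
  \sum_(p <- s) excess R p + \sum_(p <- s) 1 / p%:R :> R.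
Proof.
rewrite -big_split /=; elim: s => [|p s IH] /=; first by rewrite !big_nil ln1.
move=> /andP[p1 s1]; rewrite !big_cons -IH // /excess subrK.
have x1 : 1 < p%:R :> R by rewrite ltr1n.
rewrite lnM // posrE; first by rewrite divr_gt0 //; lra.
by apply: lt_le_trans ltr01 _; exact: prod_ratio_ge1.
Qed.

(** The inverse of the product is the product of the factors [1 - 1 / p], so this is the Weierstrass
    product inequality. *)
Lemma one_sub_inv_prod_ratio_le (R : realType) (s : seq nat) : all (ltn 1) s ->
  1 - (\prod_(p <- s) (p%:R / (p%:R - 1)))^-1 <= \sum_(p <- s) 1 / p%:R :> R.
Proof.
elim: s => [|p s IH] /=; first by rewrite !big_nil invr1 subrr.
move=> /andP[p1 s1]; rewrite !big_cons.
have x1 : 1 < p%:R :> R by rewrite ltr1n.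
have := IH s1; have := prod_ratio_ge1 R s1.
set P := \prod_(p <- s) _; set X := \sum_(p <- s) _ => P1 hX.
have -> : (p%:R / (p%:R - 1) * P)^-1 = P^-1 - P^-1 / p%:R.
  by field; rewrite subr_eq0 !gt_eqF //; lra.
have : P^-1 / p%:R <= 1 / p%:R.
  by rewrite ler_pM2r ?invf_le1 ?invr_gt0 //; lra.
by move: hX; lra.
Qed.

Lemma sum_inv_primes_ge (R : realType) (q : nat) (s : seq nat) (S : R) :
  path ltn q s -> all prime (q :: s) ->
  S = \prod_(p <- q :: s) (p%:R / (p%:R - 1)) - 2 ->
  ln 2 - 25 / (64 * q%:R) + S / 2 - S ^+ 2 / 4 <= \sum_(p <- q :: s) 1 / p%:R.
Proof.
move=> qs prs SE.
have gt1s : all (ltn 1) (q :: s) by apply: sub_all prs => p /prime_gt1.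
have P1 := prod_ratio_ge1 R gt1s; have lnP := ln_prod_ratio R gt1s.
have /andP[/prime_gt1 q1 _] := prs.
move: q1; rewrite leq_eqVlt => /predU1P[q2|q3].
  (* The factor of 2 in the product is 2, so [S / 2 = P - 1] with [P] the product over the odd
     primes. *)
  rewrite SE -q2 !big_cons.
  have /andP[_ gt1s'] := gt1s.
  have := prod_ratio_ge1 R gt1s'; have := one_sub_inv_prod_ratio_le R gt1s'.
  set P := \prod_(p <- s) _; set X := \sum_(p <- s) _ => hX P_ge1.
  have : (P - 1) - (P - 1) ^+ 2 <= 1 - P^-1.
    rewrite -subr_ge0.
    have -> : 1 - P^-1 - (P - 1 - (P - 1) ^+ 2) = (P - 1) ^+ 3 / P.
      by field; rewrite gt_eqF //; lra.
    by rewrite divr_ge0 ?exprn_ge0 //; lra.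
  have := ln2_le R; have -> : 2 / (2 - 1) * P - 2 = 2 * (P - 1) :> R by field.
  by move: hX; set l := ln 2; move: (P^-1) => ?; nra.
have := sum_excess_le R q3 qs prs.
move: SE P1 lnP.
set P := \prod_(p <- _) _; set E := \sum_(p <- _) _; set X := \sum_(p <- _) _.
move=> SE P1 lnP hE; have PE : P = 2 * (1 + S / 2) by rewrite SE; field.
have hu : S / 2 - S ^+ 2 / 4 <= ln (1 + S / 2).
  have -> : S ^+ 2 / 4 = (S / 2) ^+ 2 by field.
  by apply: ln_ge_sub_sqr; lra.
have lnPE : ln P = ln 2 + ln (1 + S / 2) by rewrite PE lnM ?posrE //; lra.
by move: hE hu lnP; rewrite lnPE; set x := 25 / _; lra.
Qed.

Theorem proposition4 (R : realType) (n k : nat) (p a : nat -> nat)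
  (p_prime : forall i : nat, (1 <= i <= k)%N -> prime (p i))
  (p_incr : forall i j : nat, (1 <= i)%N -> (i < j)%N -> (j <= k)%N ->
    (p i < p j)%N)
  (a_ge1 : forall i : nat, (1 <= i <= k)%N -> (1 <= a i)%N)
  (n_factorization : n = (\prod_(1 <= i < k.+1) p i ^ a i)%N)
  (n_primitive : primitive_nondeficient n) :
  let S := surplus R n in
  T R n >= ln 2 - 25 / (64 * (p 1%N)%:R) + S / 2 - S ^+ 2 / 4.
Proof.
have p1_le q : q \in primes n -> (p 1%N <= q)%N.
  rewrite mem_primes => /and3P[q_pr _]; rewrite n_factorization big_nat_cond.
  elim/big_ind: _ => [|x y IHx IHy|i /andP[i_range _]].
  - by rewrite dvdn1 => /eqP q1; rewrite q1 in q_pr.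
  - by rewrite Euclid_dvdM // => /orP[].
  rewrite Euclid_dvdX // => /andP[+ _].
  rewrite dvdn_prime2 // ?p_prime // => /eqP ->.
  have /andP[] := i_range; rewrite leq_eqVlt => /predU1P[<- //|i_gt1 ik].
  by rewrite ltnW // p_incr.
rewrite /surplus /T /H.
have prs : all prime (primes n).
  by apply/allP => q; rewrite mem_primes => /andP[].
case primesE: (primes n) p1_le prs (sorted_primes n) => [|q s] p1_le prs qs.
  rewrite !big_nil; have := ln2_le R.
  have : 0 <= 25 / (64 * (p 1%N)%:R) :> R by rewrite divr_ge0 // mulr_ge0.
  by set x := 25 / _; lra.
have k_gt0 : (0 < k)%N.
  rewrite lt0n; apply/eqP => k0.
  by move: primesE; rewrite n_factorization k0 big_geq.
have p1_gt0 : 0 < (p 1%N)%:R :> R by rewrite ltr0n prime_gt0 // p_prime.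
have q_ge : (p 1%N)%:R <= q%:R :> R by rewrite ler_nat p1_le ?mem_head.
have := sum_inv_primes_ge qs prs (erefl (_ : R)).
have : 25 / (64 * q%:R) <= 25 / (64 * (p 1%N)%:R) :> R.
  by rewrite ler_pM2l // lef_pV2 ?posrE; lra.
by set x := 25 / _; set y := 25 / _; lra.
Qed.
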